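(* Let $1\le k\le n-1$, let $I\in\binom{[n]}{k}$, and let $I=I_1\sqcup\dots\sqcup I_l$, $S_1,\dots,S_l$ and $E(S_1),\dots,E(S_l)$ be the cyclic data of $I$. Then for every $x\in\Delta_{k,n}$, $$\widehat\theta_I(x)=\min\{f_{\Pi_1}(x),f_{\Pi_2}(x),\dots,f_{\Pi_l}(x)\},$$ where for $2\le i\le l$ $$f_{\Pi_i}(x)=\sum_{m=1}^{E(S_{i-1})}x_m+\big|I_1\setminus[1,E(S_1)]\big|+|I_i|+|I_{i+1}|+\dots+|I_l|,$$ and $$f_{\Pi_1}(x)=\sum_{m=1}^{E(S_l)}x_m+\big|I_1\setminus[1,E(S_1)]\big|.$$
   Context: Notation: $[n]=\{1,\dots,n\}$, $[1,m]=\{1,\dots,m\}$, $e_J=\sum_{i\in J}e_i$, $\Delta_{k,n}=\{x\in[0,1]^n : \sum_{i=1}^nx_i=k\}$. For $k$-subsets $L=\{l_1<\dots<l_k\}$ and $I=\{i_1<\dots<i_k\}$ of $[n]$, write $L\le_G I$ if $l_r\le i_r$ for all $r$. The Schubert matroid $\Omega_I$ is the matroid on $[n]$ whose bases are the $k$-subsets $L$ with $L\le_G I$; its rank function is $\theta_I(S)=\max\{|S\cap L| : L\text{ a basis of }\Omega_I\}$. Its concave extension $\widehat\theta_I:[0,1]^n\to\mathbb R$ is $\widehat\theta_I(x)=\max\{\sum_J\lambda_J\theta_I(J):\lambda_J\ge0,\sum_J\lambda_J=1,\sum_J\lambda_Je_J=x\}$ (sum over $J\subseteq[n]$). Cyclic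 data of $I$: let $I=I_1\sqcup\dots\sqcup I_l$ be the unique decomposition of $I$ into maximal cyclic intervals of $[n]$ (cyclic order $1<2<\dots<n<1$), listed in cyclic order. Let $C_i$ be the cyclic interval lying between $I_{i-1}$ and $I_i$ (indices mod $l$; if $l=1$, $C_1=[n]\setminus I$). Then $[n]$ is the cyclic concatenation $(C_1,I_1,\dots,C_l,I_l)$. Put $S_i=(C_i,I_i)$, the cyclic interval consisting of $C_i$ followed by $I_i$; the indexing is chosen so that $1\in S_1$. $E(S_i)$ denotes the last element of the cyclic interval $S_i$ (in its cyclic order, i.e. the last element of $I_i$). *)

(* Defs.v *)
From HB Require Import structures.
From mathcomp Require Import all_boot all_order all_algebra.
From mathcomp Require Import all_classical all_reals all_analysis.
From mathcomp Require Import zify.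
Import Order.TTheory GRing.Theory Num.Theory.
Import numFieldNormedType.Exports.

Set Implicit Arguments.
Unset Strict Implicit.
Unset Printing Implicit Defensive.

Local Open Scope classical_set_scope.
Local Open Scope ring_scope.

(* The ground set {1, ..., n} is 'I_n, the ordinal j standing for the element  *)
(* [label j] = j + 1. The cyclic successor of j is [ordS j].                   *)
Definition label n (j : 'I_n) : nat := j.+1.

Section SchubertMatroid.
Variable n : nat.
Implicit Types I L S : {set 'I_n}.

(* [enum L] lists L increasingly; [all2] is false on lists of different sizes. *)
Definition gale_le L I : bool :=
  all2 (fun a b : 'I_n => (a <= b)%N) (enum L) (enum I).

Definition schubert_bases I : {set {set 'I_n}} :=
  [set L : {set 'I_n} | (#|L| == #|I|) && gale_le L I].

Definition schubert_rank I S : nat :=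
  (\max_(L in schubert_bases I) #|S :&: L|)%N.

End SchubertMatroid.

Section ConcaveExtension.
Variables (R : realType) (n : nat).
Implicit Types (x : 'rV[R]_n) (theta : {set 'I_n} -> R).

Definition unit_cube : set 'rV[R]_n :=
  [set x | forall j, 0 <= x ord0 j <= 1].

Definition hypersimplex (k : nat) : set 'rV[R]_n :=
  [set x | unit_cube x /\ \sum_j x ord0 j = k%:R].

Definition set_vertex (J : {set 'I_n}) : 'rV[R]_n :=
  \row_j (j \in J)%:R.

Definition vertex_weights x : set ({set 'I_n} -> R) :=
  [set lam | [/\ forall J, 0 <= lam J,
                 \sum_J lam J = 1
               & \sum_J lam J *: set_vertex J = x]].

(* The supremum is a maximum on the whole cube: see concave_extension_max.     *)
Definition concave_extension theta x : R :=
  sup [set \sum_J lam J * theta J | lam in vertex_weights x].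

End ConcaveExtension.

Section CyclicData.
Variable n : nat.
Implicit Types (I : {set 'I_n}) (s t : seq 'I_n).

(* Cyclic intervals are sequences, listed in their cyclic order: as bare sets, *)
(* intervals equal to the whole ground set would not have a last element.      *)
Definition cyclic_interval s : bool := uniq s && sorted (frel (@ordS n)) s.

Definition maximal_cyclic_interval I s : Prop :=
  [/\ s != [::], cyclic_interval s, {subset s <= I}
    & forall t, cyclic_interval t -> {subset t <= I} ->
        {subset s <= t} -> {subset t <= s}].

(* The l.+1 blocks are indexed from 0: B i is I_{i+1} and C i is C_{i+1}.      *)
Definition cyclic_segment l (C B : 'I_l.+1 -> seq 'I_n) (i : 'I_l.+1) :
  seq 'I_n := C i ++ B i.

(* A duplicate-free listing of the ground set along [ordS] in which the blocks *)
(* B i cover I: the blocks are disjoint and occur in cyclic order, and C i     *)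
(* consists of the elements between the block preceding B i and B i.           *)
Record cyclic_data I l (C B : 'I_l.+1 -> seq 'I_n) : Prop := CyclicData {
  cyclic_data_maximal : forall i, maximal_cyclic_interval I (B i);
  cyclic_data_cover : I = (\bigcup_i [set j in B i])%SET;
  cyclic_data_gap : forall i, cyclic_interval (C i);
  cyclic_data_concat :
    cyclic_interval (flatten [seq cyclic_segment C B i | i <- enum 'I_l.+1]);
  cyclic_data_full :
    forall j, j \in flatten [seq cyclic_segment C B i | i <- enum 'I_l.+1];
  cyclic_data_first :
    exists2 j : 'I_n, label j = 1%N & j \in cyclic_segment C B ord0
}.

(* The 1-based last element; the default 0 is never reached on cyclic data.    *)
Definition segment_end l (C B : 'I_l.+1 -> seq 'I_n) (i : 'I_l.+1) : nat :=
  last 0%N [seq label j | j <- cyclic_segment C B i].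

(* [ord_pred i] is i - 1 mod l.+1; in particular it is the last index at i = 0.*)
Definition segment_bound (R : realType) l (C B : 'I_l.+1 -> seq 'I_n)
    (i : 'I_l.+1) (x : 'rV[R]_n) : R :=
  \sum_(j | (label j <= segment_end C B (ord_pred i))%N) x ord0 j
  + (#|[set j in B ord0] :\:
       [set j : 'I_n | (label j <= segment_end C B ord0)%N]|%SET)%:R
  + (if i == ord0 then 0
     else (\sum_(p < l.+1 | (i <= p)%N) #|[set j in B p]%SET|)%:R).

End CyclicData.

Section ConcaveExtensionMax.
Variables (R : realType) (n : nat).
Implicit Types (x : 'rV[R]_n) (theta : {set 'I_n} -> R).

Lemma vertex_weights_nonempty x : unit_cube x -> vertex_weights x !=set0.
Proof.
move=> x01.
exists (fun J : {set 'I_n} => \prod_j (if j \in J then x ord0 j else 1 - x ord0 j)).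
split=> [J||].
- apply: prodr_ge0 => j _; have /andP[x0 x1] := x01 j.
  by case: ifP; rewrite ?subr_ge0.
- transitivity (\prod_j (x ord0 j + (1 - x ord0 j))).
    by rewrite bigA_distr.
  by apply: big1 => j _; rewrite addrC subrK.
- apply/rowP => i; rewrite summxE.
  under eq_bigr => J _ do rewrite !mxE.
  transitivity (\prod_j (x ord0 j + (1 - x ord0 j) * (j != i)%:R)); last first.
    rewrite (bigD1 i)//= eqxx mulr0 addr0 big1 ?mulr1// => j ->.
    by rewrite mulr1 addrC subrK.
  rewrite bigA_distr; apply: eq_bigr => J _.
  rewrite (bigD1 i)//= [RHS](bigD1 i)//= eqxx mulr0; case: ifP => _; last by rewrite mulr0 mul0r.
  by rewrite mulr1; congr (_ * _); apply: eq_bigr => j ->; rewrite mulr1.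
Qed.

Lemma concave_extension_max theta x : unit_cube x ->
  (exists2 lam, vertex_weights x lam
     & concave_extension theta x = \sum_J lam J * theta J) /\
  (forall lam, vertex_weights x lam ->
     \sum_J lam J * theta J <= concave_extension theta x).
Proof.
move=> /vertex_weights_nonempty[lam0 w0].
pose T : finType := ({set 'I_n} : finType).
pose coef (v : 'rV[R]_#|T|) (J : T) := v ord0 (enum_rank J).
pose vec (lam : T -> R) : 'rV[R]_#|T| := \row_p lam (enum_val p).
have vecK lam : coef (vec lam) = lam.
  by apply/funext => J; rewrite /coef mxE enum_rankK.
have sum_cont (F : T -> R) : continuous (fun v => \sum_J coef v J * F J).
  apply: continuous_big => [|J _ v]; first exact: add_continuous.
  apply: (@continuousM _ _ (coef ^~ J)); last exact: cst_continuous.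
  exact: coord_continuous.
pose A := [set v | vertex_weights x (coef v)].
have cA : compact A.
  have cK := @rV_compact R #|T| (fun=> `[0, 1]%classic)
    (fun=> @segment_compact R 0 1).
  apply: subclosed_compact cK _; last first.
    move=> v [v0 v1 _] p /=; rewrite in_itv/=.
    have vE : v ord0 p = coef v (enum_val p) by rewrite /coef enum_valK.
    rewrite vE v0 -v1 (bigD1 (enum_val p))//= lerDl.
    by apply: sumr_ge0 => J _; exact: v0.
  have -> : A = (\bigcap_J [set v | 0 <= coef v J]) `&`
     ([set v | \sum_J coef v J * 1 = 1] `&`
     \bigcap_i [set v | \sum_J coef v J * set_vertex R J ord0 i = x ord0 i]).
    rewrite predeqE => v; split=> [[v0 v1 vx]|[v0 [v1 vx]]].
      split=> [J _|]; first exact: v0.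
      split=> /= [|i _ /=]; first by under eq_bigr do rewrite mulr1.
      by rewrite -vx summxE; apply: eq_bigr => J _; rewrite !mxE.
    split=> [J||]; first exact: v0.
      by move: v1 => /=; under eq_bigr do rewrite mulr1.
    apply/rowP => i; rewrite -(vx i)//= summxE.
    by apply: eq_bigr => J _; rewrite !mxE.
  apply: closedI; [|apply: closedI].
  - apply: closed_bigI => J _.
    apply: (@preimage_closed _ _ (coef ^~ J) [set y | 0 <= y]).
      by move=> v _; exact: coord_continuous.
    exact: closed_ge.
  - apply: (@preimage_closed _ _ (fun v => \sum_J coef v J * 1) [set y | y = 1]).
      by move=> v _; exact: sum_cont.
    exact: closed_eq.
  - apply: closed_bigI => i _.
    apply: (@preimage_closed _ _
      (fun v => \sum_J coef v J * set_vertex R J ord0 i) [set y | y = x ord0 i]).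
      by move=> v _; exact: sum_cont.
    exact: closed_eq.
have A0 : A !=set0 by exists (vec lam0); rewrite /A/= vecK.
have [|v vA vmax] := EVT_max_rV A0 cA (f := fun v => \sum_J coef v J * theta J).
  by apply: continuous_subspaceT => v; exact: sum_cont.
have {}vmax lam : vertex_weights x lam ->
    \sum_J lam J * theta J <= \sum_J coef v J * theta J.
  by move=> wl; have := vmax (vec lam); rewrite vecK; apply; rewrite inE /A/= vecK.
have {}vA : vertex_weights x (coef v) by move: vA; rewrite inE.
suff E : concave_extension theta x = \sum_J coef v J * theta J.
  by split=> [|lam wl]; [exists (coef v)|rewrite E; exact: vmax].
have ubv : ubound [set \sum_J lam J * theta J | lam in vertex_weights x]
    (\sum_J coef v J * theta J) by move=> _ [lam wl <-]; exact: vmax.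
apply/eqP; rewrite eq_le; apply/andP; split.
  by apply: ge_sup => //; exists (\sum_J coef v J * theta J); exists (coef v).
apply: ub_le_sup; last by exists (coef v).
by exists (\sum_J coef v J * theta J).
Qed.

End ConcaveExtensionMax.

Section CyclicDataExists.
Variables (n : nat) (I : {set 'I_n}).
Implicit Types (b c s t : seq 'I_n) (P : seq (seq 'I_n * seq 'I_n)).

Let runs_ok (p : seq 'I_n * seq 'I_n) : bool :=
  [&& p.1 != [::], p.2 != [::], all (fun j => j \notin I) p.1
    & all (fun j => j \in I) p.2].

Let join P := flatten [seq p.1 ++ p.2 | p <- P].

Lemma runs_exist j0 s : j0 \notin I -> last j0 s \in I ->
  exists2 P, all runs_ok P & join P = j0 :: s.
Proof.
have [m] := ubnP (size s); elim: m => // m IHm in j0 s *.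
rewrite ltnS => sm j0I lI.
pose c := j0 :: take (find (mem I) s) s; pose r := drop (find (mem I) s) s.
have hs : has (mem I) s.
  case/lastP: s lI {sm c r} => [|s y]; first by rewrite /= (negPf j0I).
  by rewrite last_rcons has_rcons => /= ->.
have fs : (find (mem I) s < size s)%N by rewrite -has_find.
have rE : r = nth j0 s (find (mem I) s) :: behead r.
  by rewrite /r (drop_nth j0).
have hI : nth j0 s (find (mem I) s) \in I by exact: (@nth_find _ j0 (mem I)).
have cI : all (fun j => j \notin I) c.
  rewrite /= j0I /=; apply/(all_nthP j0) => i; rewrite size_take fs => ifs.
  by rewrite nth_take//; apply/negP => sI; have := before_find j0 ifs; rewrite /= sI.
pose b := take (find [predC I] r) r; pose q := drop (find [predC I] r) r.
have sE : j0 :: s = c ++ b ++ q by rewrite /c /= /b /q !cat_take_drop.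
have bI : all (fun j => j \in I) b.
  apply/(all_nthP j0) => i; rewrite size_take_min leq_min => /andP[ir _].
  rewrite nth_take//; have := before_find j0 ir => /=.
  by move/negbT; rewrite negbK.
have b0 : b != [::] by rewrite /b rE /= hI.
have ok : runs_ok (c, b) by rewrite /runs_ok b0 /= bI; move: cI => /= ->.
case qE : q => [|y q'].
  by exists [:: (c, b)]; rewrite /= ?ok// sE qE /join /= !cats0.
have yI : y \notin I.
  have hr : has [predC I] r.
    by rewrite has_find; have := congr1 size qE; rewrite size_drop /=; lia.
  have := nth_find j0 hr; rewrite /= -[find _ _]addn0 -nth_drop -/q qE /=.
  by rewrite unfold_in.
have [||P okP PE] := IHm y q' _ yI.
- have := congr1 size sE; rewrite qE !size_cat /= => -[sz].
  by move: sm; rewrite sz; lia.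
- move: lI; have -> : last j0 s = last j0 (j0 :: s) by [].
  by rewrite sE qE !last_cat.
exists ((c, b) :: P); first by rewrite /= ok.
by rewrite sE qE -PE /join /= catA.
Qed.

Lemma join_cat P1 P2 : join (P1 ++ P2) = join P1 ++ join P2.
Proof. by rewrite /join map_cat flatten_cat. Qed.

Lemma sorted_cycle s t : fcycle (@ordS n) (s ++ t) -> sorted (frel (@ordS n)) s.
Proof.
case: s => //= x s; rewrite rcons_cat cat_path => /andP[]; done.
Qed.

Lemma run_maximal c b r : runs_ok (c, b) -> all runs_ok r ->
  uniq (c ++ b ++ join r) -> fcycle (@ordS n) (c ++ b ++ join r) ->
  maximal_cyclic_interval I b.
Proof.
move=> /and4P[/= c0 b0 cI bI] okr.
have [y yI [r' rE]] : exists2 y, y \notin I & exists r', join r ++ c = y :: r'.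
  case: r okr => [_|[c1 b1] r /andP[/and4P[/= c10 _ c1I _] _]].
    by case: c c0 cI => // y c _ /andP[yI _]; exists y => //; exists c.
  case: c1 c10 c1I => // y c1 _ /andP[yI _]; exists y => //.
  by exists ((c1 ++ b1 ++ join r) ++ c); rewrite /join /= -!catA.
case/lastP: c c0 cI rE => // c z _ + rE; rewrite all_rcons => /andP[zI cI].
rewrite cycle_catC -catA rE => U F; have {}F : fcycle (@ordS n) (b ++ y :: r') by [].
have Ub : uniq b by move: U; rewrite !cat_uniq => /and3P[_ _ /and3P[]].
split=> //; first by rewrite /cyclic_interval Ub (sorted_cycle F).
  by move=> j jb; exact: (allP bI).
move=> t /andP[Ut St] tI bt.
have zE : last y r' = z.
  by rewrite -[last y r']/(last z (y :: r')) -rE last_cat last_rcons.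
case: b b0 bI bt {U Ub} F => // b1 b _ bI bt.
rewrite (cycle_path b1) last_cat /= zE => /andP[/eqP zb].
rewrite cat_path /= => /and3P[/fpathE bE /eqP yE _].
have b1t : b1 \in t by apply: bt; rewrite mem_head.
case/splitPr: b1t St Ut tI bt => t1 t2; case/lastP: t1 => [|t1 w]; last first.
  rewrite cat_rcons => St _ tI _.
  have wb : ordS w = b1.
    by move: St; rewrite sorted_cat_cons /= => /and3P[_ /eqP].
  have wz : w = z by apply: (@ordS_inj n); rewrite wb zb.
  by have := tI w; rewrite mem_cat mem_head orbT wz (negPf zI) => /(_ isT).
rewrite cat0s /= => /fpathE tE _ tI _.
have tb : (size t2 <= size b)%N.
  rewrite leqNgt; apply/negP => bt2.
  have : y \in t2.
    rewrite tE; apply/trajectP; exists (size b) => //.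
    by rewrite -yE {1}bE last_traject -iterSr -iterS.
  by move=> yt; have := tI y; rewrite inE yt orbT (negPf yI) => /(_ isT).
move=> j; rewrite !inE => /orP[->//|]; rewrite {1}tE => /trajectP[i it ->].
by apply/orP; right; rewrite bE; apply/trajectP; exists i => //; exact: leq_trans tb.
Qed.

Lemma fcycle_enum : fcycle (@ordS n) (enum 'I_n).
Proof.
case: n => [|m]; first by rewrite enum_ord0 || (case: (enum _) => // -[]).
rewrite (cycle_path ord0) -(nth_last ord0) size_enum_ord /=.
apply/(pathP ord0) => i; rewrite size_enum_ord => im.
case: i im => [|i] im /=.
  by apply/eqP/val_inj; rewrite /= !nth_enum_ord//= modnn.
by apply/eqP/val_inj; rewrite /= !nth_enum_ord ?(ltnW im)//= modn_small.
Qed.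

Lemma cyclic_data_exists : (0 < #|I| < n)%N ->
  exists l (C B : 'I_l.+1 -> seq 'I_n), cyclic_data I C B.
Proof.
case/andP=> I0 In; have Un := enum_uniq 'I_n; have Fn := fcycle_enum.
have [e eI SeI] : exists2 e, e \in I & ordS e \notin I.
  have [e eI] := card_gt0P I0; apply: contrapT => nex.
  have SI j : j \in I -> ordS j \in I.
    by move=> jI; apply: contrapT => /negP SjI; apply: nex; exists j.
  have [i s sE] := rot_to (mem_enum 'I_n e).
  have /fpathE sT : fpath (@ordS n) e s.
    by move: Fn; rewrite -(rot_cycle i) sE /= rcons_path => /andP[].
  have itI k : iter k (@ordS n) e \in I by elim: k => //= k; exact: SI.
  suff : #|I| = n by move=> IE; rewrite IE ltnn in In.
  rewrite -[RHS]card_ord; apply: eq_card => j; rewrite [RHS]inE.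
  have : j \in e :: s by rewrite -sE mem_rot mem_enum.
  rewrite inE sT => /orP[/eqP -> //|/trajectP[k _ ->]].
  by rewrite -iterSr; exact: itI.
have [i0 s sE] := rot_to (mem_enum 'I_n (ordS e)).
have lE : last (ordS e) s = e.
  apply: (@ordS_inj n); apply/eqP.
  by move: Fn; rewrite -(rot_cycle i0) sE /= rcons_path => /andP[].
have [|P okP PE] := @runs_exist (ordS e) s SeI; first by rewrite lE.
have n0 : (0 < n)%N by exact: leq_ltn_trans In.
have fullP j : j \in join P by rewrite PE -sE mem_rot mem_enum.
have /flattenP[_ /mapP[p pP ->] p0] := fullP (Ordinal n0).
have UP : uniq (join P) by rewrite PE -sE rot_uniq.
have FP : fcycle (@ordS n) (join P) by rewrite PE -sE rot_cycle.
case/splitPr: pP okP fullP UP FP {PE} => P1 P2 okP fullP UP FP.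
set Q := p :: P2 ++ P1.
have QE : join Q = join (p :: P2) ++ join P1 by rewrite -join_cat.
have okQ : all runs_ok Q.
  by move: okP; rewrite /Q -cat_cons !all_cat andbC.
have UQ : uniq (join Q) by rewrite QE uniq_catC -join_cat.
have FQ : fcycle (@ordS n) (join Q) by rewrite QE cycle_catC -join_cat.
have fullQ j : j \in join Q.
  by have := fullP j; rewrite QE join_cat !mem_cat orbC.
pose l := size (P2 ++ P1); have sQ : size Q = l.+1 by [].
pose q0 : seq 'I_n * seq 'I_n := ([::], [::]).
pose C (i : 'I_l.+1) := (nth q0 Q i).1; pose B (i : 'I_l.+1) := (nth q0 Q i).2.
have CBE : flatten [seq cyclic_segment C B i | i <- enum 'I_l.+1] = join Q.
  congr flatten; apply: (@eq_from_nth _ [::]).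
    by rewrite size_map size_enum_ord size_map.
  move=> k; rewrite size_map size_enum_ord => kl.
  rewrite (nth_map ord0) ?size_enum_ord// (nth_map q0)//.
  by rewrite /cyclic_segment /C /B nth_enum_ord.
have okn (i : 'I_l.+1) : runs_ok (nth q0 Q i) by apply: (all_nthP q0 okQ).
have splitQ (i : 'I_l.+1) : exists Q1 Q2, Q = Q1 ++ (C i, B i) :: Q2.
  exists (take i Q), (drop i.+1 Q); rewrite /C /B -surjective_pairing.
  by rewrite -drop_nth ?cat_take_drop// sQ.
have rotQ (i : 'I_l.+1) : exists r, [/\ all runs_ok r,
    uniq (C i ++ B i ++ join r) & fcycle (@ordS n) (C i ++ B i ++ join r)].
  have [Q1 [Q2 QQ]] := splitQ i; exists (Q2 ++ Q1).
  have jE : C i ++ B i ++ join (Q2 ++ Q1) = join ((C i, B i) :: Q2) ++ join Q1.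
    by rewrite join_cat /join /= -!catA.
  rewrite !jE; split.
  - by move: okQ; rewrite QQ !all_cat /= => /and3P[-> _ ->].
  - by rewrite uniq_catC -join_cat -QQ.
  - by rewrite cycle_catC -join_cat -QQ.
exists l, C, B; split.
- move=> i'; have [r [okr Ur Fr]] := rotQ i'.
  apply: (@run_maximal (C i') (B i') r) => //.
  by rewrite /C /B -surjective_pairing.
- apply/setP => j; apply/idP/bigcupP => [jI|[i' _]]; last first.
    by rewrite inE; have /and4P[_ _ _ /allP] := okn i'; apply.
  have /flattenP[_ /mapP[q qQ ->]] := fullQ j.
  have qi : (index q Q < l.+1)%N by rewrite -sQ index_mem.
  have qE : nth q0 Q (Ordinal qi) = q by rewrite /= nth_index.
  rewrite mem_cat => /orP[jq|jq]; last first.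
    by exists (Ordinal qi) => //; rewrite inE /B qE.
  have /and4P[_ _ /allP qI _] := okn (Ordinal qi).
  by have := qI j; rewrite qE jI => /(_ jq).
- move=> i'; have [r [_ Ur Fr]] := rotQ i'.
  by rewrite /cyclic_interval (sorted_cycle Fr); move: Ur; rewrite cat_uniq => /andP[->].
- by rewrite CBE /cyclic_interval UQ (@sorted_cycle _ [::]) ?cats0.
- by move=> j; rewrite CBE.
- by exists (Ordinal n0).
Qed.

End CyclicDataExists.

(* Main.v *)
(* Put X m = x_1 + ... + x_m and g m = X m + |I \ [1, m]|. Basis exchange gives *)
(* theta_I S = min_m (|S :&: [1, m]| + |I \ [1, m]|), so averaging over weights *)
(* representing x bounds the extension by every g m. For the lower bound, let t *)
(* be uniform on [0, 1] and let J_t be the set of j at which floor (X j + t)    *)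
(* jumps. Then J_t has mean x, and as c |-> floor (c + t) commutes with minima  *)
(* and with adding integers and has mean c, theta_I J_t has mean min_m g m.     *)
(* Read cyclically (g 0 = g n on the hypersimplex), g weakly increases at       *)
(* elements outside I and weakly decreases at elements of I, so its minimum is  *)
(* reached at the end of a block of I, where g is a segment bound.              *)

Require Import Defs.
From HB Require Import structures.
From mathcomp Require Import all_boot all_order all_algebra.
From mathcomp Require Import all_classical all_reals all_analysis.
From mathcomp Require Import zify ring lra.
Import Order.TTheory GRing.Theory Num.Theory.
Import numFieldNormedType.Exports.

Set Implicit Arguments.
Unset Strict Implicit.
Unset Printing Implicit Defensive.

Local Open Scope classical_set_scope.
Local Open Scope ring_scope.

(** * Rank of a Schubert matroid as a minimum over cuts of the ground set *)

Section Rank.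
Variable n : nat.
Implicit Types I L S : {set 'I_n}.

(** The rank of [S] is the least of the cuts |S ∩ [1,m]| + |I \ [1,m]| ([schubert_rank_le],
    [schubert_rank_attained]). Each cut extends affinely to a [cut_bound], which bounds the concave
    extension from above ([concave_extension_le_cut]). Equality calls for one representation of [x]
    by sets whose prefix counts all agree with those of [x] up to rounding; systematic sampling
    provides it, and averaging over the random shift removes the rounding ([concave_extension_ge]).
    The formulas of the theorem are the cuts at segment ends ([segment_bound_cut]), and no other cut
    lies below all of these ([cut_bound_min]). *)

Lemma all2_leq_count (s t : seq nat) (m : nat) : all2 leq s t ->
  (count (gtn m) t <= count (gtn m) s)%N.
Proof.
elim: s t => [|a s IHs] [|b t] //= /andP[ab /IHs]; lia.
Qed.

(** If the heads satisfied b < a, the threshold b + 1 would count b in [t] and nothing in [s]. *)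
Lemma all2_leq_sorted (s t : seq nat) : size s = size t ->
  sorted ltn s -> sorted ltn t ->
  (forall m, (count (gtn m) t <= count (gtn m) s)%N) -> all2 leq s t.
Proof.
elim: s t => [|a s IHs] [|b t] //= [st] sa sb le_count.
have aP := order_path_min ltn_trans sa; have bP := order_path_min ltn_trans sb.
have no_count c u m : all (ltn c) u -> (m <= c)%N -> count (gtn m) u = 0%N.
  move=> cu mc; apply/eqP; rewrite -leqn0 leqNgt -has_count.
  by apply/hasPn => z zu; have /= := allP cu z zu; lia.
have ab : (a <= b)%N.
  rewrite leqNgt; apply/negP => ba; have := le_count b.+1.
  by rewrite (no_count a s _ aP) //= ltnSn ltnNge ba.
rewrite ab IHs ?(path_sorted sa) ?(path_sorted sb)// => m.
have [mb|bm] := leqP m b; first by rewrite (no_count b).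
by have := le_count m; rewrite bm (leq_ltn_trans ab bm) !leq_add2l.
Qed.

(** In 1-based labels this is the interval [1,m]. *)
Definition below (m : nat) : {set 'I_n} := [set j : 'I_n | (j < m)%N].

Lemma count_below L m :
  count (gtn m) (map (@nat_of_ord n) (enum L)) = #|L :&: below m|.
Proof.
rewrite count_map cardE -size_filter; congr size.
rewrite /enum_mem -!filter_predI.
by apply: eq_filter => j; rewrite /= !inE andbC.
Qed.

Lemma sorted_enum_set L : sorted ltn (map (@nat_of_ord n) (enum L)).
Proof.
apply: (subseq_sorted ltn_trans) (iota_ltn_sorted 0 n).
by rewrite -val_enum_ord enumT map_subseq // /enum_mem filter_subseq.
Qed.

Lemma schubert_basesP I L :
  reflect (#|L| = #|I| /\ forall m, (#|I :&: below m| <= #|L :&: below m|)%N)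
    (L \in schubert_bases I).
Proof.
have -> : (L \in schubert_bases I) = (#|L| == #|I|) &&
    all2 leq (map (@nat_of_ord n) (enum L)) (map (@nat_of_ord n) (enum I)).
  rewrite inE; congr andb; rewrite /gale_le.
  by elim: (enum L) (enum I) => [|a s IHs] [|b t] //=; rewrite IHs.
apply: (iffP andP) => -[/eqP cLI LI]; split.
- by [].
- by move=> m; rewrite -!count_below; exact: all2_leq_count.
- by rewrite (eqP cLI).
- apply: all2_leq_sorted; rewrite ?sorted_enum_set// ?size_map -?cardE ?(eqP cLI)//.
  by move=> m; rewrite !count_below.
Qed.

(** Split S ∩ L at m: the lower part lies in S, and a basis [L] has at most as many elements above m
    as [I] has. *)
Lemma schubert_rank_le I S m :
  (schubert_rank I S <= #|S :&: below m| + #|I :\: below m|)%N.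
Proof.
apply/bigmax_leqP => L /schubert_basesP[cLI /(_ m) LI].
have := cardsID (below m) L; have := cardsID (below m) I.
have := cardsID (below m) (S :&: L).
have := subset_leq_card (finset.setSI (below m) (finset.subsetIl S L)).
have := subset_leq_card (finset.setSD (below m) (finset.subsetIr S L)).
lia.
Qed.

Lemma schubert_rank_attained I S : exists2 m,
  (m <= n)%N & (#|S :&: below m| + #|I :\: below m| <= schubert_rank I S)%N.
Proof.
have I_basis : I \in schubert_bases I by apply/schubert_basesP.
rewrite /schubert_rank (bigop.bigmax_eq_arg I I_basis).
case: arg_maxnP => // L /schubert_basesP[cLI LI] Lmax.
have {}Lmax L' : L' \in schubert_bases I -> (#|S :&: L'| <= #|S :&: L|)%N := Lmax L'.
have [SL|/subsetPn[e0 e0S e0L]] := boolP (S \subset L).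
  exists n => //; have -> : I :\: below n = finset.set0.
    by apply/setP => j; rewrite !inE ltn_ord.
  by rewrite cards0 addn0 (finset.setIidPl SL) subset_leq_card// finset.subsetIl.
(* For L maximal, e the least element of S :\: L and m the last tight cut below *)
(* e, exchanging e with any f in L :\: S above m would improve L.              *)
have e0P : e0 \in S :\: L by rewrite inE e0S e0L.
case: (arg_minnP (fun j : 'I_n => val j) e0P) => e /finset.setDP[eS eL] emin.
have {}emin (j : 'I_n) : j \in S :\: L -> (e <= j)%N := emin j.
pose tight m := (m <= e)%N && (#|L :&: below m| == #|I :&: below m|).
have below0 : below 0 = finset.set0 by apply/setP => j; rewrite !inE.
have tight0 : tight 0%N by rewrite /tight below0 !finset.setI0 cards0.
have tight_le m : tight m -> (m <= e)%N by case/andP.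
case: (ex_maxnP (ex_intro (fun m => tight m) _ tight0) tight_le).
move=> m /andP[me /eqP mt] mmax.
exists m; first exact: leq_trans me (ltnW (ltn_ord e)).
have Sm : S :&: below m \subset (S :&: L) :&: below m.
  apply/fintype.subsetP => j; rewrite !inE => /andP[jS jm]; rewrite jS jm andbT /=.
  apply: contraLR jm => jL; rewrite -leqNgt.
  by apply: leq_trans me (emin j _); rewrite inE jL.
have Lm : L :\: below m \subset (S :&: L) :\: below m.
  apply/fintype.subsetP => f; rewrite !inE => /andP[fm fL]; rewrite fm fL andbT /=.
  apply: contraT => fS; have fe : f != e by apply: contraNneq fS => ->.
  pose L' := e |: (L :\ f).
  suff : L' \in schubert_bases I.
    move=> /Lmax; have -> : S :&: L' = e |: (S :&: L).
      apply/setP => j; rewrite !inE; have [->|] := eqVneq j e; first by rewrite eS.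
      by have [->|] := eqVneq j f; rewrite ?(negPf fS)//=.
    by rewrite cardsU1 inE (negPf eL) andbF; lia.
  apply/schubert_basesP; split.
    by rewrite cardsU1 !inE (negPf eL) andbF -cLI (cardsD1 f L) fL.
  (* Cuts q > e gain e, which pays for f; cuts q <= e with q <= f are unchanged; if f < q <= e,
     maximality of m makes q not tight, and the slack absorbs the loss of f. *)
  move=> q; have := LI q.
  have -> : L' :&: below q = if (e < q)%N then e |: ((L :&: below q) :\ f)
                             else (L :&: below q) :\ f.
    apply/setP => j; case: ifP => eq; rewrite !inE.
      by have [->|] := eqVneq j e; rewrite ?eq //= andbA.
    by have [->|] := eqVneq j e; rewrite ?eq ?(negPf eL) ?andbF //= andbA.
  rewrite (cardsD1 f (L :&: below q)) !inE fL /=.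
  case: ifP => eq.
    by rewrite cardsU1 !inE (negPf eL) /= andbF; case: (f < q)%N; lia.
  case: ltnP => fq; last by lia.
  have : ~~ tight q by apply: contraL fq => /mmax; lia.
  rewrite /tight (cardsD1 f (L :&: below q)) !inE fL fq /=; lia.
have := cardsID (below m) L; have := cardsID (below m) I.
have := cardsID (below m) (S :&: L).
have := subset_leq_card Sm; have := subset_leq_card Lm; lia.
Qed.

End Rank.

(** * Exact averaging of shifted floors by finitely many shifts *)

Section Dithering.
Variable R : realType.
Implicit Types (p a c : R) (s : seq R).

Definition gap_weight p s i : R := s`_i - (p :: s)`_i.

Lemma gap_weight_ge0 p s (i : 'I_(size s)) : path <=%R p s -> 0 <= gap_weight p s i.
Proof. by move=> /(pathP 0)/(_ i (ltn_ord i)); rewrite subr_ge0. Qed.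

(** A left-endpoint Riemann sum of the indicator of [a, ∞), exact because a is a partition point or
    does not exceed the first one. *)
Lemma sum_gap_weight p s a : path <=%R p s -> a <= p \/ a \in p :: s ->
  \sum_(i < size s) gap_weight p s i * (a <= (p :: s)`_i)%R%:R =
  last p s - Num.max a p.
Proof.
rewrite /gap_weight.
elim: s p => [|q s IHs] p /= sp ap.
  by rewrite big_ord0 max_r ?subrr//; case: ap => //; rewrite inE => /eqP ->.
case/andP: sp => pq sq; rewrite big_ord_recl /=.
have [le_ap|lt_pa] := leP a p.
  rewrite mulr1 IHs//; last by left; exact: le_trans pq.
  by rewrite (max_r (le_trans le_ap pq)); ring.
have aqs : a \in q :: s.
  by case: ap => [|]; rewrite ?leNgt ?lt_pa// inE gt_eqF.
rewrite mulr0 add0r IHs//; last by right.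
suff /max_l-> : q <= a by [].
move: aqs; rewrite inE => /predU1P[->//|].
exact: (allP (order_path_min le_trans sq)).
Qed.

(* As t increases from 0 to 1, floor (c + t) jumps from floor c to floor c + 1 *)
(* at t = 1 - (c - floor c).                                                   *)
Lemma floor_shift c (t : R) : 0 <= t <= 1 ->
  (Num.floor (c + t))%:~R =
  (Num.floor c)%:~R + (1 - (c - (Num.floor c)%:~R) <= t)%R%:R :> R.
Proof.
move=> /andP[t0 t1]; have /andP[] := floor_itv c; rewrite intrD => fc cf.
have -> : (1 - (c - (Num.floor c)%:~R) <= t)%R%:R =
    ((1 - (c - (Num.floor c)%:~R) <= t)%R : nat)%:~R :> R.
  by case: (_ <= _).
rewrite -intrD; congr _%:~R; apply: floor_def; rewrite !intrD.
by have [] := leP (1 - (c - (Num.floor c)%:~R)) t => ?;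
  rewrite ?mulr1z ?mulr0z; apply/andP; split; lra.
Qed.

(** A finite form of the integral of floor (c + t) over [0,1] being c. Cutting [0,1] at the jumps of
    all c in [cs] makes one Riemann sum exact for all of them; left endpoints are right since the
    floor is right-continuous. *)
Lemma floor_dithering (cs : seq R) : exists q (w t : 'I_q -> R),
  [/\ forall i, 0 <= w i, \sum_i w i = 1
    & forall c, c \in cs -> \sum_i w i * (Num.floor (c + t i))%:~R = c].
Proof.
pose jump c := 1 - (c - (Num.floor c)%:~R) : R.
have jump01 c : 0 <= jump c <= 1.
  by have /andP[] := floor_itv c; rewrite intrD /jump => *; apply/andP; split; lra.
pose r := sort <=%R (map jump cs); pose s := rcons r 1.
have r01 : all (fun a => 0 <= a <= 1) r.
  by apply/allP => a; rewrite mem_sort => /mapP[c _ ->].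
have sP : path <=%R 0 s.
  rewrite rcons_path path_min_sorted ?sort_le_sorted /=; last first.
    by apply/allP => a /(allP r01)/andP[].
  have : last 0 r \in 0 :: r by rewrite mem_last.
  by rewrite inE => /predU1P[->//|/(allP r01)/andP[]].
have w1 : \sum_(i < size s) gap_weight 0 s i = 1.
  rewrite -[RHS](_ : last 0 s - Num.max 0 0 = 1); last first.
    by rewrite last_rcons maxxx subr0.
  rewrite -(sum_gap_weight sP); last by left.
  apply: eq_bigr => i _; have s0 := order_path_min le_trans sP.
  suff ti : (0 :: s)`_i \in 0 :: s.
    have /allP/(_ _ ti)/= -> : all (>= 0) (0 :: s) by rewrite /= lexx.
    by rewrite mulr1.
  by rewrite mem_nth//= ltnS ltnW.
exists (size s), (fun i => gap_weight 0 s i), (fun i => (0 :: s)`_i).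
split=> // [i|c ccs]; first exact: gap_weight_ge0.
under eq_bigr => i _.
  rewrite floor_shift ?mulrDr; first over.
  have : (0 :: s)`_i \in 0 :: s by rewrite mem_nth//= ltnS ltnW.
  rewrite inE mem_rcons inE => /predU1P[->|/predU1P[->|/(allP r01)//]];
    by rewrite lexx ler01.
rewrite big_split/= -mulr_suml w1 mul1r (sum_gap_weight sP).
  by rewrite last_rcons max_l ?(andP (jump01 c)).1 // /jump; ring.
right; rewrite inE mem_rcons inE mem_sort; apply/orP; right; apply/orP; right.
exact: map_f.
Qed.

End Dithering.

(** * The concave extension as the minimum of all cut bounds *)

Section SchubertExtension.
Variables (R : realType) (n : nat).
Implicit Types (I J S : {set 'I_n}) (x : 'rV[R]_n).

Definition prefix_sum x (m : nat) : R := \sum_(j < n | (j < m)%N) x ord0 j.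

Lemma prefix_sum0 x : prefix_sum x 0 = 0.
Proof. by rewrite /prefix_sum big_pred0. Qed.

Lemma prefix_sumS x (j : 'I_n) : prefix_sum x j.+1 = prefix_sum x j + x ord0 j.
Proof.
rewrite /prefix_sum (bigD1 j)//= addrC; congr (_ + _); apply: eq_bigl => i.
by rewrite ltnS [RHS]ltn_neqAle andbC -val_eqE.
Qed.

Definition cut_bound I x (m : nat) : R := prefix_sum x m + #|I :\: below n m|%:R.

Lemma card_prefix_sum J m :
  #|J :&: below n m|%:R = \sum_(j < n | (j < m)%N) (j \in J)%:R :> R.
Proof.
rewrite -sum1_card natr_sum big_mkcond [RHS]big_mkcond; apply: eq_bigr => j _.
by rewrite !inE; case: (j \in J); case: (j < m)%N.
Qed.

Lemma vertex_weights_prefix x lam m : vertex_weights x lam ->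
  \sum_J lam J * #|J :&: below n m|%:R = prefix_sum x m.
Proof.
case=> _ _ <-; under eq_bigr do rewrite card_prefix_sum mulr_sumr.
rewrite exchange_big; apply: eq_bigr => j _; rewrite summxE.
by apply: eq_bigr => J _; rewrite !mxE.
Qed.

Lemma concave_extension_le_cut I x m : unit_cube x ->
  concave_extension (fun S => (schubert_rank I S)%:R) x <= cut_bound I x m.
Proof.
move=> x01; have [[lam wlam ->] _] :=
  concave_extension_max (fun S => (schubert_rank I S)%:R) x01.
rewrite /cut_bound -(vertex_weights_prefix m wlam); case: wlam => lam0 lam1 _.
rewrite -[X in _ + X]mul1r -[X in _ + X * _]lam1 mulr_suml -big_split/=.
rewrite ler_sum// => J _.
by rewrite -mulrDr -natrD ler_wpM2l// ler_nat schubert_rank_le.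
Qed.

(* Systematic sampling: over t the prefix counts are floor (X m + t) - floor t, *)
(* so the set of jumps realizes all prefix sums X m up to rounding at once.     *)
Definition sample x (t : R) : {set 'I_n} :=
  [set j : 'I_n | Num.floor (prefix_sum x j + t) < Num.floor (prefix_sum x j.+1 + t)].

(** Since x_j lies in [0,1], the floor rises by 0 or 1 across j. *)
Lemma sample_indicator x t j : unit_cube x ->
  (j \in sample x t)%:R =
  (Num.floor (prefix_sum x j.+1 + t))%:~R - (Num.floor (prefix_sum x j + t))%:~R
  :> R.
Proof.
move=> /(_ j)/andP[x0 x1]; rewrite inE prefix_sumS.
set y := prefix_sum x j + t; set z := _ + t; have zE : z = y + x ord0 j.
  by rewrite /y /z; ring.
have := le_floor (_ : y <= z); rewrite {1}zE lerDl => /(_ x0) yz.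
have : Num.floor z < Num.floor y + 1 + 1.
  have /andP[_] := floor_itv y; have /andP[+ _] := floor_itv z.
  by rewrite -(ltr_int R) !intrD => *; lra.
move=> zy; have [fyz|fyz] := ltP (Num.floor y) (Num.floor z).
  have -> : Num.floor z = Num.floor y + 1 by lia.
  by rewrite intrD addrC addKr.
have -> : Num.floor z = Num.floor y by lia.
by rewrite subrr.
Qed.

Lemma card_sample x t m : unit_cube x -> (m <= n)%N ->
  #|sample x t :&: below n m|%:R =
  (Num.floor (prefix_sum x m + t))%:~R - (Num.floor t)%:~R :> R.
Proof.
move=> x01; rewrite card_prefix_sum; elim: m => [_|m IHm mn].
  by rewrite big_pred0// prefix_sum0 add0r subrr.
rewrite (bigD1 (Ordinal mn))//= addrC.
under eq_bigl => i.
  rewrite ltnS -val_eqE /= andbC -ltn_neqAle; over.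
rewrite IHm ?(ltnW mn)// (sample_indicator _ _ x01) /=; ring.
Qed.

Lemma concave_extension_ge I x c : unit_cube x ->
  (forall m, (m <= n)%N -> c <= cut_bound I x m) ->
  c <= concave_extension (fun S => (schubert_rank I S)%:R) x.
Proof.
move=> x01 c_le.
have [q [w [t [w0 w1 wE]]]] :=
  (* The prefix sums make the sample have mean [x], 0 cancels the mean of floor t, and c serves the
     final estimate. *)
  floor_dithering [:: 0, c & [seq prefix_sum x m | m <- iota 0 n.+1]].
have w_floor : \sum_i w i * (Num.floor (t i))%:~R = 0.
  by under eq_bigr do rewrite -[t _]add0r; rewrite wE ?mem_head.
have w_prefix m : (m <= n)%N ->
    \sum_i w i * (Num.floor (prefix_sum x m + t i))%:~R = prefix_sum x m.
  by move=> mn; rewrite wE// 2!in_cons map_f ?orbT// mem_iota ltnS.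
(* The law of the random set [sample x (t i)] when i has probability [w i]. *)
pose lam (J : {set 'I_n}) := \sum_i w i * (sample x (t i) == J)%:R.
have sum_lam (V : lmodType R) (F : {set 'I_n} -> V) :
    \sum_J lam J *: F J = \sum_i w i *: F (sample x (t i)).
  under eq_bigr do rewrite scaler_suml.
  rewrite exchange_big; apply: eq_bigr => i _; rewrite (bigD1 (sample x (t i)))//=.
  rewrite eqxx mulr1 big1 ?addr0// => J; rewrite eq_sym => /negPf ->.
  by rewrite mulr0 scale0r.
have sum_lamR F : \sum_J lam J * F J = \sum_i w i * F (sample x (t i)).
  exact: (sum_lam R^o F).
have wlam : vertex_weights x lam.
  split=> [J||].
  - by apply: sumr_ge0 => i _; rewrite mulr_ge0.
  - transitivity (\sum_J lam J * 1); first by apply: eq_bigr => J _; rewrite mulr1.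
    by rewrite sum_lamR -[RHS]w1; apply: eq_bigr => i _; rewrite mulr1.
  - rewrite sum_lam; apply/rowP => j; rewrite summxE.
    under eq_bigr => i _ do rewrite !mxE (sample_indicator _ _ x01) mulrBr.
    by rewrite sumrB !w_prefix ?(ltnW (ltn_ord j))// prefix_sumS addrC addKr.
have [_ /(_ _ wlam)] := concave_extension_max (fun S => (schubert_rank I S)%:R) x01.
apply: le_trans; rewrite sum_lamR.
(* It now suffices to compare for each shift: at the cut m attaining the rank of the sample, the
   integer |I \ [1,m]| moves inside the floor, which is then at least floor (c + t). *)
have <- : \sum_i w i * ((Num.floor (c + t i))%:~R - (Num.floor (t i))%:~R) = c.
  under eq_bigr do rewrite mulrBr.
  by rewrite sumrB w_floor subr0 wE// !inE eqxx orbT.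
apply: ler_sum => i _; apply: ler_wpM2l => //.
have [m mn] := schubert_rank_attained I (sample x (t i)).
rewrite -(ler_nat R) => /(le_trans _); apply.
rewrite natrD card_sample// addrAC lerD2r.
set N := #|I :\: _|; have -> : (Num.floor (prefix_sum x m + t i))%:~R + N%:R =
    (Num.floor (prefix_sum x m + t i + N%:R))%:~R :> R.
  by rewrite [in RHS]floorDrz ?natr_int// intrD (_ : N%:R = N%:~R)// intrKfloor.
rewrite ler_int le_floor//.
by have := c_le m mn; rewrite /cut_bound -/N; lra.
Qed.

End SchubertExtension.

(** * Walks along the cyclic successor *)

Section CyclicOrder.
Variable n : nat.

Lemma val_iter_ordS d (j : 'I_n) : iter d (@ordS n) j = ((j + d) %% n)%N :> nat.
Proof.
elim: d => [|d IHd] /=; first by rewrite addn0 modn_small.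
by rewrite IHd -addn1 modnDml addn1 addnS.
Qed.

Lemma iter_ordS_reach (i j : 'I_n) : exists d, iter d (@ordS n) i = j.
Proof.
exists (j + (n - i))%N; apply/val_inj; rewrite /= val_iter_ordS.
have -> : (i + (j + (n - i)) = j + n)%N by have := ltn_ord i; lia.
by rewrite modnDr modn_small.
Qed.

(** A repetition-free walk starting at 0 has at most n elements, so it never wraps around. *)
Lemma mem_initial_segment (z j : 'I_n) s : z = 0%N :> nat ->
  uniq (z :: s) -> fpath (@ordS n) z s -> (j \in z :: s) = (j <= last z s)%N.
Proof.
move=> z0 Us /fpathE sE.
have sn : (size s < n)%N.
  rewrite -[X in (_ < X)%N]card_ord -[(size s).+1]/(size (z :: s)).
  by rewrite -(card_uniqP Us) max_card.
have it d : (d <= size s)%N -> iter d (@ordS n) z = d :> nat.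
  by move=> ds; rewrite val_iter_ordS z0 modn_small// (leq_ltn_trans ds).
have -> : z :: s = traject (@ordS n) z (size s).+1 by rewrite trajectS -sE.
have -> : last z s = size s :> nat by rewrite {1}sE last_traject it.
apply/trajectP/idP => [[d ds ->]|js]; first exact: leq_trans (eq_leq (it d ds)) ds.
by exists j => //; apply/val_inj/esym/it.
Qed.

(** From j walk backwards until [I] is met, then forwards to the end of that run of [I]; h never
    increases on the way. *)
Lemma cyclic_descent (R : realType) (I : {set 'I_n}) (h : 'I_n -> R) (j : 'I_n) :
  I != finset.set0 -> I != [set: 'I_n]%SET ->
  (forall i, i \in I -> ordS i \in I -> h (ordS i) <= h i) ->
  (forall i, ordS i \notin I -> h i <= h (ordS i)) ->
  exists2 e, (e \in I) && (ordS e \notin I) & h e <= h j.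
Proof.
move=> /finset.set0Pn[a aI] IT h_in h_out.
have [b bI] : exists b, b \notin I.
  apply/existsP; rewrite -negb_forall; apply: contra IT => /forallP IT.
  by apply/eqP/setP => i; rewrite IT inE.
have forward i : i \in I -> exists2 e, (e \in I) && (ordS e \notin I) & h e <= h i.
  have [d] := iter_ordS_reach i b; elim: d i => [|d IHd] i.
    by move=> /= -> bI'; rewrite bI' in bI.
  rewrite iterSr => db iI; have [SiI|SiI] := boolP (ordS i \in I).
    by have [e eP he] := IHd _ db SiI; exists e => //; apply: le_trans he (h_in _ _ _).
  by exists i; rewrite ?iI.
suff [i iI hi] : exists2 i, i \in I & h i <= h j.
  by have [e eP he] := forward i iI; exists e => //; exact: le_trans hi.
have [d] := iter_ordS_reach a j; elim: d j => [|d IHd] j /=.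
  by move=> <-; exists a.
move=> jE; have [jI|] := boolP (j \in I); first by exists j.
rewrite -jE => /h_out hj; have [i iI hi] := IHd _ erefl.
by exists i => //; exact: le_trans hi hj.
Qed.

End CyclicOrder.

(** * Segment ends as the decisive cuts *)

Section CyclicSegments.
Variables (n : nat) (I : {set 'I_n}) (l : nat) (C B : 'I_l.+1 -> seq 'I_n).
Hypothesis cdI : cyclic_data I C B.

Let S := cyclic_segment C B.
Let segments := flatten [seq S p | p <- enum 'I_l.+1].

Lemma segment_endE z q : segment_end C B q = (last z (S q)).+1.
Proof.
have [+ _ _ _] := cyclic_data_maximal cdI q.
rewrite /segment_end /S /cyclic_segment; case: (B q) => // b s _.
by rewrite map_cat !last_cat /= last_map.
Qed.

(** Were e not last in its block, its successor would be in the same block, hence in [I]. *)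
Lemma block_end_segment_end e : e \in I -> ordS e \notin I ->
  exists q, segment_end C B q = e.+1.
Proof.
rewrite {1}(cyclic_data_cover cdI) => /bigcupP[q _]; rewrite inE => eB SeI.
have [_ /andP[_ Bs] BI _] := cyclic_data_maximal cdI q.
exists q; rewrite (segment_endE e) /S /cyclic_segment; congr _.+1.
case/splitPr: eB BI Bs => s1 [|e' s2] BI; first by rewrite !last_cat.
rewrite sorted_cat_cons /= => /and3P[_ /eqP eS _].
by case/negP: SeI; rewrite eS BI// mem_cat !inE eqxx !orbT.
Qed.

Lemma segments_uniq : uniq segments.
Proof. by have /andP[] := cyclic_data_concat cdI. Qed.

Lemma mem_segment_inj j p q : j \in S p -> j \in S q -> p = q.
Proof.
move=> jp jq; apply/eqP; apply: contraT => pq.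
have := count_uniq_mem j segments_uniq; rewrite count_flatten -map_comp sumnE.
rewrite big_map big_enum (bigD1 p)//= (bigD1 q)//=; last by rewrite eq_sym.
move: jp jq; rewrite -!has_pred1 !has_count.
by case: (ltnP 0 (count_mem j segments)) => /=; lia.
Qed.

Lemma mem_segment_block j p : j \in S p -> (j \in I) = (j \in B p).
Proof.
move=> jS; apply/idP/idP => [|jB]; last first.
  by have [_ _ BI _] := cyclic_data_maximal cdI p; exact: BI.
rewrite {1}(cyclic_data_cover cdI) => /bigcupP[q _]; rewrite inE => jq.
by rewrite (@mem_segment_inj j p q)// /S /cyclic_segment mem_cat jq orbT.
Qed.

Lemma segment_uniq p : uniq (S p).
Proof.
have := segments_uniq; rewrite /segments.
have : p \in enum 'I_l.+1 by rewrite mem_enum.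
case/splitPr => s1 s2; rewrite map_cat flatten_cat cat_uniq => /and3P[_ _].
by rewrite /= cat_uniq => /andP[].
Qed.

Lemma count_segment p : count (mem I) (S p) = #|[set j in B p]%SET|.
Proof.
have /andP[_ /andP[_ UB]] : [&& uniq (C p), ~~ has (mem (C p)) (B p) & uniq (B p)].
  by rewrite -cat_uniq; exact: segment_uniq.
rewrite cardsE; have /card_uniqP -> := UB.
rewrite (eq_in_count (a2 := mem (B p))) => [|j /mem_segment_block//].
have := segment_uniq p; rewrite /S /cyclic_segment cat_uniq count_cat.
case/and3P => _ CB _; rewrite -[RHS]add0n; congr (_ + _)%N.
  apply/eqP; rewrite -leqn0 leqNgt -has_count has_sym //.
by apply/eqP; rewrite -all_count; apply/allP.
Qed.

Lemma mem_take_enum_ord m (p : 'I_l.+1) : (p \in take m (enum 'I_l.+1)) = (p < m)%N.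
Proof.
rewrite -(mem_map val_inj) map_take val_enum_ord take_iota mem_iota /= add0n.
by rewrite leq_min ltn_ord andbT.
Qed.

Lemma mem_drop_enum_ord m (p : 'I_l.+1) : (p \in drop m (enum 'I_l.+1)) = (m <= p)%N.
Proof.
rewrite -(mem_map val_inj) map_drop val_enum_ord drop_iota mem_iota add0n.
have [mp|//] := leqP m p; have pl := ltn_ord p.
by rewrite subnKC //= (leq_trans mp (ltnW pl)).
Qed.

Let after (q : 'I_l.+1) := flatten [seq S p | p <- drop q.+1 (enum 'I_l.+1)].

Lemma count_after q :
  count (mem I) (after q) = (\sum_(p < l.+1 | (q < p)%N) #|[set j in B p]%SET|)%N.
Proof.
rewrite /after count_flatten -map_comp sumnE big_map.
transitivity (\sum_(p in 'I_l.+1 | (q < p)%N) #|[set j in B p]%SET|)%N; last first.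
  exact: eq_bigl.
rewrite -big_enum_cond /= -[in RHS](cat_take_drop q.+1 (enum _)) big_cat /=.
rewrite [X in _ = (X + _)%N](_ : _ = 0%N); last first.
  rewrite big_seq_cond big_pred0 // => p.
  by rewrite mem_take_enum_ord ltnS ltnNge andbN.
rewrite add0n [RHS]big_seq_cond [LHS]big_seq_cond; apply: eq_big => [p|p _].
  by rewrite mem_drop_enum_ord; case: (q < p)%N.
exact: count_segment.
Qed.

(* The ground set starts at z = 0 inside the first segment, whose part u before *)
(* z has wrapped around: the elements after segment q are u and after q.        *)
Lemma segments_split : exists u (z : 'I_n), [/\ z = 0%N :> nat, {subset u <= S ord0}
  & forall q, exists2 s, segments = u ++ (z :: s) ++ after q
                        & (last z s).+1 = segment_end C B q].
Proof.
have [z [z0] zS] := cyclic_data_first cdI.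
have [u [s0 S0]] : exists u s0, S ord0 = u ++ z :: s0.
  by rewrite /S; case/splitPr: zS => u s0; exists u, s0.
exists u, z; split=> // [j ju|q]; first by rewrite S0 mem_cat ju.
have qE : take q.+1 (enum 'I_l.+1) = rcons (take q (enum 'I_l.+1)) q.
  rewrite (take_nth q) ?size_enum_ord//; congr rcons.
  by apply/val_inj; rewrite /= nth_enum_ord.
have [s sE] : exists s,
    flatten [seq S p | p <- take q.+1 (enum 'I_l.+1)] = u ++ z :: s.
  rewrite enum_ordSl /= S0 -catA /=.
  by eexists.
exists s.
  by rewrite catA -sE -flatten_cat -map_cat cat_take_drop.
rewrite (segment_endE z); congr (nat_of_ord _).+1.
transitivity (last z (u ++ z :: s)); first by rewrite last_cat.
rewrite -sE qE map_rcons flatten_rcons last_cat.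
have [+ _ _ _] := cyclic_data_maximal cdI q.
by rewrite /S /cyclic_segment; case: (B q) => // b s' _; rewrite !last_cat.
Qed.

(** Past the end of segment q lie the wrapped part u of the first segment and the segments after q.
    [I] meets the latter in their blocks, and meets u in the part of the first block beyond the end
    of its segment. *)
Lemma card_above_segment_end q :
  #|I :\: below n (segment_end C B q)| =
  (#|[set j in B ord0]%SET :\: below n (segment_end C B ord0)| +
   \sum_(p < l.+1 | (q < p)%N) #|[set j in B p]%SET|)%N.
Proof.
have [u [z [z0 uS split_at]]] := segments_split.
have above p j : (j \notin below n (segment_end C B p)) = (j \in u ++ after p).
  have [s sE <-] := split_at p.
  have jseg : j \in segments := cyclic_data_full cdI j.
  have Us := segments_uniq; have /andP[_ Ss] := cyclic_data_concat cdI.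
  rewrite -/segments sE in jseg Us Ss.
  have [Uzs nzs] : uniq (z :: s) /\ (j \in z :: s -> j \notin u ++ after p).
    move: Us; rewrite uniq_catCA cat_uniq => /and3P[Uzs /hasPn nzs _].
    by split=> //; apply: contraTN => /nzs.
  have fzs : fpath (@ordS n) z s.
    by have /cat_sorted2[_ /cat_sorted2[]] := Ss.
  rewrite inE ltnS -(mem_initial_segment j z0 Uzs fzs).
  apply/idP/idP => [|jua]; last by apply/negP => /nzs; rewrite jua.
  by move: jseg; rewrite !mem_cat orbCA => /orP[->//|].
have Uua p : uniq (u ++ after p).
  have [s sE _] := split_at p; have := segments_uniq.
  by rewrite sE uniq_catCA cat_uniq => /and3P[].
have card_filter (s : seq 'I_n) (A : {set 'I_n}) : uniq s -> A =i seq.filter (mem I) s ->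
    #|A| = count (mem I) s.
  move=> Us Es; rewrite -size_filter (eq_card Es).
  exact/card_uniqP/seq.filter_uniq.
rewrite (card_filter (u ++ after q))// => [|j]; last first.
  by rewrite inE above mem_filter andbC.
rewrite count_cat count_after; congr (_ + _)%N; apply/esym/card_filter.
  by have := Uua ord0; rewrite cat_uniq => /and3P[].
move=> j; rewrite finset.in_setD above finset.in_set mem_filter mem_cat /=.
apply/andP/andP => -[].
  case/orP => [ju jB|/flattenP[_ /mapP[p pq ->] jp] jB].
    by rewrite (mem_segment_block (uS _ ju)).
  have p0 : ord0 = p.
    by apply: mem_segment_inj jp; rewrite /S /cyclic_segment mem_cat jB orbT.
  by move: pq; rewrite -p0 mem_drop_enum_ord.
by move=> jI ju; rewrite ju -(mem_segment_block (uS _ ju)).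
Qed.

Lemma segment_bound_cut (R : realType) (x : 'rV[R]_n) i :
  segment_bound C B i x = cut_bound I x (segment_end C B (ord_pred i)).
Proof.
rewrite /segment_bound /cut_bound card_above_segment_end natrD addrA; congr (_ + _).
case: eqVneq => [->|i0].
  (* Here [ord_pred ord0] is the last index, so no block follows the cut. *)
  by rewrite big_pred0// => p /=; rewrite modn_small// ltnNge -ltnS ltn_ord.
congr _%:R; apply: eq_bigl => p /=.
have i_gt0 : (0 < i)%N by rewrite lt0n -val_eqE /= in i0 *.
have -> : ((i + l.+1).-1 = i.-1 + l.+1)%N by lia.
by rewrite modnDr modn_small ?prednK// ltnW.
Qed.

(** Crossing j changes the cut bound by x_j - [j ∈ I], and the cuts 0 and n agree as the coordinates
    sum to |I|; so [cyclic_descent] applies and stops at a segment end. *)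
Lemma cut_bound_min (R : realType) (x : 'rV[R]_n) (c : R) m :
  hypersimplex #|I| x -> (0 < #|I| < n)%N -> (m <= n)%N ->
  (forall i, c <= segment_bound C B i x) -> c <= cut_bound I x m.
Proof.
move=> [x01 xk] /andP[I_gt0 I_lt] mn c_le.
pose h (j : 'I_n) := cut_bound I x j.+1.
have cutS (j : 'I_n) : h j = cut_bound I x j + x ord0 j - (j \in I)%:R.
  rewrite /h /cut_bound prefix_sumS.
  suff -> : #|I :\: below n j| = (#|I :\: below n j.+1| + (j \in I))%N.
    by rewrite natrD; ring.
  rewrite (cardsD1 j (I :\: below n j)) !inE ltnn /= addnC; congr (_ + _)%N.
  apply: eq_card => i; rewrite !inE -!leqNgt andbA; congr andb.
  by rewrite ltn_neqAle -val_eqE eq_sym.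
have cutn : cut_bound I x n = #|I|%:R.
  rewrite /cut_bound -xk -[RHS]addr0; congr (_ + _).
    by apply: eq_bigl => j; rewrite ltn_ord.
  rewrite (_ : I :\: _ = finset.set0) ?cards0//.
  by apply/setP => j; rewrite !inE ltn_ord.
have cut0 : cut_bound I x 0 = #|I|%:R.
  rewrite /cut_bound prefix_sum0 add0r; congr _%:R.
  by apply: eq_card => j; rewrite !inE.
have n_gt0 : (0 < n)%N by exact: leq_ltn_trans I_lt.
have [j hj] : exists j, h j = cut_bound I x m.
  case: m mn => [_|m mn]; last by exists (Ordinal mn).
  have n1 : (n.-1 < n)%N by rewrite prednK.
  (* [h] only covers the cuts 1 to n; the cut 0 is represented by n. *)
  by exists (Ordinal n1); rewrite /h /= prednK// cutn cut0.
have hS i : h (ordS i) = h i + x ord0 (ordS i) - (ordS i \in I)%:R.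
  rewrite cutS; congr (_ + _ - _); rewrite /h /=.
  have [->|iSn] := eqVneq i.+1 n; first by rewrite modnn cut0 cutn.
  by rewrite modn_small// ltn_neqAle iSn ltn_ord.
have [|||i SiI|e /andP[eI SeI] he] := @cyclic_descent n R I h j.
- by rewrite -card_gt0.
- by apply: contraTneq I_lt => ->; rewrite cardsT card_ord ltnn.
- by move=> i _ SiI; have /andP[_ x1] := x01 (ordS i); rewrite hS SiI lerBlDr lerD2l.
- by have /andP[x0 _] := x01 (ordS i); rewrite hS (negPf SiI) subr0 lerDl.
have [q qE] := block_end_segment_end eI SeI.
rewrite -hj; apply: le_trans he.
by have := c_le (ordS q); rewrite segment_bound_cut ordSK qE.
Qed.

End CyclicSegments.

Theorem proposition1p4 (R : realType) (n k : nat) (I : {set 'I_n})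
    (l : nat) (C B : 'I_l.+1 -> seq 'I_n) (x : 'rV[R]_n) :
  (1 <= k <= n - 1)%N ->
  #|I| = k ->
  cyclic_data I C B ->
  hypersimplex k x ->
  concave_extension (fun S => (schubert_rank I S)%:R) x =
    \big[Num.min/segment_bound C B ord0 x]_(i < l.+1) segment_bound C B i x.
Proof.
move=> kn cI cdI xk; have [x01 _] := xk.
have I_card : (0 < #|I| < n)%N by rewrite cI; lia.
apply/eqP; rewrite eq_le; apply/andP; split.
  (* The default of the minimum is itself a segment bound, so both goals are the same estimate. *)
  by apply: le_bigmin => [|i _];
    rewrite (segment_bound_cut cdI) concave_extension_le_cut.
apply: concave_extension_ge => // m mn.
apply: (cut_bound_min cdI) => //; first by rewrite cI.
by move=> i; exact: bigmin_le.
Qed.
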